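(* Let $f:\{0,1\}^n\to\{0,1,*\}$ be a partial Boolean function with $\textnormal{R}(f)=\Theta(n)$. Then for all partial Boolean functions $g:\{0,1\}^m\to\{0,1,*\}$, \[\textnormal{R}(f\circ g)=\Omega(\textnormal{R}(f)\cdot\textnormal{R}(g)).\]
   Context: A partial Boolean function $h:\{0,1\}^n\to\{0,1,*\}$ has domain $\textnormal{Dom}(h)=h^{-1}(\{0,1\})$. For partial $f$ on $n$ bits and partial $g$ on $m$ bits, the composed partial function $f\circ g$ on $nm$ bits is $f\circ g(x_1,\dots,x_n)=f(g(x_1),\dots,g(x_n))$ for $x_i\in\{0,1\}^m$, with output $*$ if some $x_i\notin\textnormal{Dom}(g)$ or $(g(x_1),\dots,g(x_n))\notin\textnormal{Dom}(f)$. $\textnormal{R}(h)$ is the randomized query complexity: the minimum, over randomized query algorithms $A$ with $\Pr[A(x)\neq h(x)]\le 1/3$ for all $x\in\textnormal{Dom}(h)$, of the worst-case number of queries (over inputs and internal randomness). Asymptotic notation is with respect to $n\to\infty$ (families of functions). *)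

(* Defs.v *)
From HB Require Import structures.
From mathcomp Require Import all_boot all_order all_algebra.
From mathcomp Require Import all_classical all_reals all_analysis.

Set Implicit Arguments.
Unset Strict Implicit.
Unset Printing Implicit Defensive.

Import Order.TTheory GRing.Theory Num.Theory.
Import numFieldNormedType.Exports.

Local Open Scope ring_scope.

Definition bits (n : nat) := {ffun 'I_n -> bool}.

(* [None] is the output [*], so that [Dom h] is [{x | h x != None}]. *)
Definition pbool (n : nat) := bits n -> option bool.

(* [mxvec_index] enumerates the pairs (i, j) lexicographically, so the blocks
   are the n consecutive segments of length m of x. *)
Definition block (n m : nat) (x : bits (n * m)) (i : 'I_n) : bits m :=
  [ffun j => x (mxvec_index i j)].

(* The default value of [odflt] is never used: all blocks are in [Dom g]. *)
Definition pbool_comp (n m : nat) (f : pbool n) (g : pbool m) : pbool (n * m) :=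
  fun x => if [forall i, g (block x i) != None]
           then f [ffun i => odflt false (g (block x i))]
           else None.

Inductive dtree (n : nat) :=
| Leaf of bool
| Query of 'I_n & dtree n & dtree n.

Arguments Leaf {n} _.

Fixpoint eval n (t : dtree n) (x : bits n) : bool :=
  match t with
  | Leaf b => b
  | Query i t0 t1 => if x i then eval t1 x else eval t0 x
  end.

Fixpoint queries n (t : dtree n) (x : bits n) : nat :=
  match t with
  | Leaf _ => 0%N
  | Query i t0 t1 => (if x i then queries t1 x else queries t0 x).+1
  end.

(* A randomized query algorithm is a probability distribution over
   deterministic decision trees, presented through its random seed. *)
Record ralg (K : realType) (n : nat) := RAlg {
  seed : finType;
  prob : seed -> K;
  prob_ge0 : forall s, 0 <= prob s;
  prob_sum1 : \sum_s prob s = 1;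
  tree : seed -> dtree n
}.

Definition err (K : realType) n (A : ralg K n) (h : pbool n) (x : bits n) : K :=
  \sum_(s : seed A | Some (eval (tree s) x) != h x) prob s.

Definition computes (K : realType) n (A : ralg K n) (h : pbool n) : Prop :=
  forall x, h x != None -> err A h x <= 3^-1.

Definition cost (K : realType) n (A : ralg K n) : nat :=
  (\max_(s : seed A) \max_(x : bits n) queries (tree s) x)%N.

Definition achievable (K : realType) n (h : pbool n) (q : nat) : Prop :=
  exists2 A : ralg K n, computes A h & cost A = q.

Fixpoint full_tree n (h : bits n -> bool) (r : seq 'I_n) (y : bits n) :
    dtree n :=
  if r is i :: r' then
    Query i (full_tree h r' [ffun j => if j == i then false else y j])
            (full_tree h r' [ffun j => if j == i then true else y j])
  else Leaf (h y).

Lemma eval_full_tree n (h : bits n -> bool) r y x :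
  eval (full_tree h r y) x = h [ffun j => if j \in r then x j else y j].
Proof.
elim: r y => [|i r IH] y /=.
  by congr h; apply/ffunP => j; rewrite ffunE.
by case xi: (x i); rewrite IH; congr h; apply/ffunP => j;
  rewrite !ffunE inE; case: eqP => [->|]; case: ifP; rewrite ?xi.
Qed.

Lemma achievable_ex (K : realType) n (h : pbool n) :
  exists q, `[< achievable K h q >].
Proof.
pose t := full_tree (fun x => odflt false (h x)) (enum 'I_n) [ffun=> false].
have p0 (s : unit) : 0 <= (1 : K) by [].
have p1 : \sum_(s : unit) (1 : K) = 1 by rewrite sumr_const card_unit.
pose A := @RAlg K n unit (fun=> 1) p0 p1 (fun=> t).
exists (cost A); apply/asboolP; exists A => // x hx.
rewrite /err big1 ?invr_ge0 ?ler0n //= => s.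
rewrite eval_full_tree; have -> : [ffun j => if j \in enum 'I_n then x j
  else [ffun=> false] j] = x by apply/ffunP => j; rewrite ffunE mem_enum.
by case: (h x) hx => //= b _; rewrite eqxx.
Qed.

Definition rqc (K : realType) n (h : pbool n) : nat :=
  ex_minn (achievable_ex K h).

(* Main.v *)
(* Let x be the input of a tree for [f o g].  By a minimax argument there are
   distributions mu_0, mu_1 on the two preimages of g that a tree of depth d tells
   apart only with advantage O(eta), where d is at least R(g) up to a factor that
   depends on eta only (amplification).  To compute f(z),
   run the tree for [f o g] on blocks x_i drawn from mu_(z_i), sampling only the
   bits that are read, and ask z_i only when the part of the leaf probability
   shared by mu_0 and mu_1, the minimum of the two weights of the partial
   assignment of block i, has been used up.  Block i costs a query with
   probability at most O(eta) plus the probability that more than d bits of it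
   are read, so the expected number of queries is O(eta n) + T / d for a tree of
   depth T.  When R(f) >= c0 n and eta is small compared to c0, the second term
   must be of order R(f), that is, T is of order R(f) R(g). *)

Require Import Defs.
From HB Require Import structures.
From mathcomp Require Import all_boot all_order all_algebra.
From mathcomp Require Import all_classical all_reals all_analysis.
From mathcomp Require Import ring lra.

Set Implicit Arguments.
Unset Strict Implicit.
Unset Printing Implicit Defensive.

Import Order.TTheory GRing.Theory Num.Theory.
Import numFieldNormedType.Exports.

Local Open Scope classical_set_scope.
Local Open Scope ring_scope.

(* [all_analysis] exports another [eval]. *)
Local Notation eval := Defs.eval.

(** * Randomized trees and amplification *)

Section RandomizedTrees.
Variables (K : realType) (n : nat).
Implicit Types (A B : ralg K n) (x : bits n) (F : bool -> nat -> K).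

(** [F] sees the output and the query count jointly, so that error probability and expected number
    of queries are instances of one functional. *)
Definition expect A x F : K :=
  \sum_(s : seed A) prob s * F (eval (tree s) x) (queries (tree s) x).

Lemma err_expect A (h : pbool n) x :
  err A h x = expect A x (fun b _ => (Some b != h x)%:R).
Proof.
rewrite /err /expect big_mkcond; apply: eq_bigr => s _.
by case: ifP; rewrite ?mulr1 ?mulr0.
Qed.

Lemma expectD A x F G :
  expect A x (fun b q => F b q + G b q) = expect A x F + expect A x G.
Proof.
by rewrite /expect -big_split; apply: eq_bigr => s _; rewrite mulrDr.
Qed.

Lemma expectZ A x (a : K) F :
  expect A x (fun b q => a * F b q) = a * expect A x F.
Proof. by rewrite /expect mulr_sumr; apply: eq_bigr => s _; rewrite mulrCA. Qed.

Lemma queries_le_cost A s x : (queries (tree (r:=A) s) x <= cost A)%N.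
Proof.
rewrite /cost (bigD1 s) //=; apply: leq_trans (leq_maxl _ _).
by rewrite (bigD1 x) //= leq_maxl.
Qed.

Lemma cost_le A q :
  (forall s x, (queries (tree (r:=A) s) x <= q)%N) -> (cost A <= q)%N.
Proof.
by move=> Aq; apply/bigmax_leqP => s _; apply/bigmax_leqP => x _; apply: Aq.
Qed.

Lemma rqc_le A h : computes A h -> (rqc K h <= cost A)%N.
Proof.
move=> Ah; rewrite /rqc; case: ex_minnP => q _; apply.
by apply/asboolP; exists A.
Qed.

Lemma rqc_computes h : exists2 A : ralg K n, computes A h & cost A = rqc K h.
Proof. by rewrite /rqc; case: ex_minnP => q /asboolP[A Ah <-] _; exists A. Qed.

Section Mix.
Variables (I : finType) (w : I -> K) (A : I -> ralg K n).
Hypotheses (w_ge0 : forall i, 0 <= w i) (w_sum1 : \sum_i w i = 1).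

Definition mix_prob (s : {i : I & seed (A i)}) : K :=
  w (tag s) * prob (tagged s).

Lemma mix_prob_ge0 s : 0 <= mix_prob s.
Proof. by rewrite mulr_ge0 ?prob_ge0. Qed.

Lemma mix_sum (F : forall i, seed (A i) -> K) :
  \sum_(s : {i : I & seed (A i)}) mix_prob s * F (tag s) (tagged s) =
  \sum_i w i * \sum_(s : seed (A i)) prob s * F i s.
Proof.
under [RHS]eq_bigr => i _ do rewrite mulr_sumr.
rewrite sig_big_dep /=; apply: eq_bigr => -[i s] _ /=.
by rewrite /mix_prob /= mulrA.
Qed.

Lemma mix_prob_sum1 : \sum_s mix_prob s = 1.
Proof.
under eq_bigr => s _ do rewrite -[mix_prob s]mulr1.
rewrite (mix_sum (fun _ _ => 1)) -[RHS]w_sum1; apply: eq_bigr => i _.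
by under eq_bigr => s _ do rewrite mulr1; rewrite prob_sum1 mulr1.
Qed.

Definition mix : ralg K n :=
  RAlg mix_prob_ge0 mix_prob_sum1 (fun s => tree (tagged s)).

Lemma expect_mix x F : expect mix x F = \sum_i w i * expect (A i) x F.
Proof.
exact: (mix_sum (fun i s => F (eval (tree s) x) (queries (tree s) x))).
Qed.

End Mix.

(* Clamping makes the coin total; it is only tossed with a bias in [0, 1]. *)
Definition bias (p : K) (b : bool) : K :=
  let q := Num.max 0 (Num.min 1 p) in if b then q else 1 - q.

Lemma bias_ge0 p b : 0 <= bias p b.
Proof.
have q1 : Num.max 0 (Num.min 1 p) <= 1 by rewrite ge_max ler01 ge_min lexx.
by case: b; rewrite /bias ?subr_ge0 // le_max lexx.
Qed.

Lemma bias_sum1 p : \sum_b bias p b = 1.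
Proof. by rewrite big_bool /= addrC subrK. Qed.

Definition coin p A B : ralg K n :=
  mix (fun b : bool => if b then A else B) (bias_ge0 p) (bias_sum1 p).

Lemma expect_coin p A B x F : 0 <= p <= 1 ->
  expect (coin p A B) x F = p * expect A x F + (1 - p) * expect B x F.
Proof.
by case/andP=> p0 p1; rewrite expect_mix big_bool /= (min_idPr p1) (max_idPr p0).
Qed.

Lemma unit_sum1 : \sum_(s : unit) (1 : K) = 1.
Proof. by rewrite sumr_const card_unit. Qed.

Definition deterministic (t : dtree n) : ralg K n :=
  @RAlg K n unit (fun=> 1) (fun=> ler01) unit_sum1 (fun=> t).

Lemma expect_deterministic t x F :
  expect (deterministic t) x F = F (eval t x) (queries t x).
Proof. by rewrite /expect (bigD1 tt) //= big1 ?addr0 ?mul1r // => -[]. Qed.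

Section Ask.
Variables (i : 'I_n) (A0 A1 : ralg K n).

(** A seed must fix a whole tree, so the seeds of both continuations are drawn independently in
    advance; the one not followed sums out to 1. *)
Definition ask_prob (s : seed A0 * seed A1) : K := prob s.1 * prob s.2.

Lemma ask_prob_ge0 s : 0 <= ask_prob s.
Proof. by rewrite mulr_ge0 ?prob_ge0. Qed.

Lemma ask_prob_sum1 : \sum_s ask_prob s = 1.
Proof.
rewrite -(pair_bigA _ (fun s0 s1 => prob s0 * prob s1)) /=.
by under eq_bigr => s _ do rewrite -mulr_sumr prob_sum1 mulr1; rewrite prob_sum1.
Qed.

Definition ask : ralg K n :=
  RAlg ask_prob_ge0 ask_prob_sum1 (fun s => Query i (tree s.1) (tree s.2)).

Lemma expect_ask x F :
  expect ask x F = expect (if x i then A1 else A0) x (fun b q => F b q.+1).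
Proof.
rewrite /expect /= -(pair_bigA _ (fun s0 s1 => prob s0 * prob s1 *
  F (if x i then eval (tree s1) x else eval (tree s0) x)
    (if x i then queries (tree s1) x else queries (tree s0) x).+1)) /=.
case: (x i).
  rewrite exchange_big; apply: eq_bigr => s1 _ /=.
  by rewrite -mulr_suml -mulr_suml prob_sum1 mul1r.
apply: eq_bigr => s0 _; rewrite -mulr_suml -mulr_sumr prob_sum1 mulr1 //.
Qed.

End Ask.

Fixpoint dbind (t : dtree n) (u : bool -> dtree n) : dtree n :=
  match t with
  | Leaf b => u b
  | Query i t0 t1 => Query i (dbind t0 u) (dbind t1 u)
  end.

Lemma eval_dbind t u x : eval (dbind t u) x = eval (u (eval t x)) x.
Proof. by elim: t => //= i t0 -> t1 ->; case: (x i). Qed.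

Lemma queries_dbind t u x :
  queries (dbind t u) x = (queries t x + queries (u (eval t x)) x)%N.
Proof. by elim: t => //= i t0 -> t1 ->; case: (x i). Qed.

Definition maj3 (a b c : bool) := if a then b || c else b && c.

Definition dmaj3 t1 t2 t3 :=
  dbind t1 (fun a => dbind t2 (fun b => dbind t3 (fun c => Leaf (maj3 a b c)))).

Section Majority.
Variable A : ralg K n.

Definition maj_prob (s : seed A * seed A * seed A) : K :=
  prob s.1.1 * prob s.1.2 * prob s.2.

Lemma maj_prob_ge0 s : 0 <= maj_prob s.
Proof. by rewrite !mulr_ge0 ?prob_ge0. Qed.

Lemma maj_sum (u : seed A -> K) (v : seed A -> K) (w : seed A -> K) :
  \sum_s maj_prob s * (u s.1.1 * v s.1.2 * w s.2) =
  (\sum_s prob s * u s) * (\sum_s prob s * v s) * (\sum_s prob s * w s).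
Proof.
rewrite !mulr_suml.
rewrite -(pair_bigA _ (fun s0 s1 => maj_prob (s0, s1) *
   (u s0.1 * v s0.2 * w s1))) /=.
rewrite -(pair_bigA _ (fun s0 s1 => \sum_s2 maj_prob ((s0, s1), s2) *
   (u s0 * v s1 * w s2))) /=.
apply: eq_bigr => s0 _; rewrite -mulrA mulr_suml mulr_sumr.
apply: eq_bigr => s1 _; rewrite 2!mulr_sumr.
by apply: eq_bigr => s2 _; rewrite /maj_prob /=; ring.
Qed.

Lemma maj_prob_sum1 : \sum_s maj_prob s = 1.
Proof.
have := maj_sum (fun=> 1) (fun=> 1) (fun=> 1).
under eq_bigr do rewrite !mulr1; move=> ->.
by under eq_bigr do rewrite mulr1; rewrite prob_sum1 !mulr1.
Qed.

Definition majority : ralg K n :=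
  RAlg maj_prob_ge0 maj_prob_sum1
    (fun s => dmaj3 (tree s.1.1) (tree s.1.2) (tree s.2)).

Lemma err_majority h x : h x != None ->
  err majority h x = 3 * err A h x ^+ 2 - 2 * err A h x ^+ 3.
Proof.
case hx: (h x) => [v|] // _.
pose u (s : seed A) : K := (Some (eval (tree s) x) != h x)%:R.
have eE : err A h x = \sum_s prob s * u s by rewrite err_expect.
have e1 : \sum_(s : seed A) prob s * 1 = 1.
  by rewrite -[RHS](prob_sum1 A); apply: eq_bigr => s _; rewrite mulr1.
(* The majority errs exactly if at least two of the three runs err; on 0/1 values this event is uv +
   uw + vw - 2uvw. *)
transitivity (\sum_s (maj_prob s * (u s.1.1 * u s.1.2 * 1) +
    maj_prob s * (u s.1.1 * 1 * u s.2) + maj_prob s * (1 * u s.1.2 * u s.2)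
    - 2 * (maj_prob s * (u s.1.1 * u s.1.2 * u s.2)))).
  rewrite err_expect; apply: eq_bigr => -[[s1 s2] s3] _ /=.
  rewrite /dmaj3 !eval_dbind /= -!mulrDr mulrCA -mulrBr; congr (_ * _).
  rewrite /u /maj3 /= hx.
  case: v {hx}; case: (eval _ x); case: (eval _ x); case: (eval _ x);
    by rewrite /=; ring.
rewrite sumrB !big_split /= -mulr_sumr.
rewrite (maj_sum u u (fun=> 1)) (maj_sum u (fun=> 1) u) (maj_sum (fun=> 1) u u).
by rewrite (maj_sum u u u) e1 -eE; ring.
Qed.

Lemma cost_majority : (cost majority <= 3 * cost A)%N.
Proof.
apply: cost_le => -[[s1 s2] s3] x /=; rewrite /dmaj3 !queries_dbind /= addn0.
by rewrite !mulSn mul0n addn0 !leq_add ?queries_le_cost.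
Qed.

End Majority.
End RandomizedTrees.

(** A majority of three turns the advantage [de] into [de * (3/2 - 2 * de ^+ 2)], a gain of at least
    5/4 while [de] is below 1/3. The number of rounds until the advantage reaches 1/3, that is error
    1/6, depends on [de] alone, and each round triples the cost. *)
Lemma amplification (K : realType) (de : K) : 0 < de <= 2^-1 ->
  exists2 r : nat, (0 < r)%N & forall n (h : pbool n) (A : ralg K n),
    (forall x, h x != None -> err A h x <= 2^-1 - de) ->
    exists2 B : ralg K n, (forall x, h x != None -> err B h x <= 6^-1) &
      (cost B <= r * cost A)%N.
Proof.
case/andP=> de0 de2.
(* By Bernoulli's inequality, (5/4)^j >= 1 + j/4. *)
have [j] : exists j, 3^-1 <= (5/4) ^+ j * de.
  exists (Num.bound (4 / de)); move: (Num.bound _) (archi_boundP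
    (divr_ge0 (ler0n K 4) (ltW de0))) => j; rewrite ltr_pdivrMr // => j4.
  have : 1 + j%:R / 4 <= (5/4) ^+ j :> K.
    elim: j {j4} => [|j IH]; first by rewrite expr0 mul0r addr0.
    rewrite exprS -natr1; have : 0 <= j%:R :> K by []. by lra.
  by move=> /(ler_wpM2r (ltW de0)); lra.
elim: j de de0 de2 => [|j IH] de de0 de2 jde.
  exists 1%N => // n h A Ah; exists A; last by rewrite mul1n.
  by move=> x /Ah /le_trans; apply; rewrite expr0 in jde; lra.
have [de3|de3] := leP 3^-1 de.
  apply: IH => //; apply: (le_trans de3).
  by apply: ler_peMl; [exact: ltW|apply: exprn_ege1; lra].
pose de' := de * (3/2 - 2 * de ^+ 2).
have de'E : 5/4 * de <= de' by rewrite /de'; nra.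
have de'2 : de' <= 2^-1 by rewrite /de'; nra.
have de'0 : 0 < de' by lra.
have [|r r0 Hr] := IH _ de'0 de'2.
  apply: (le_trans jde); rewrite exprSr -mulrA ler_wpM2l // exprn_ge0 //; lra.
exists (r * 3)%N => [|n h A Ah]; first by rewrite muln_gt0 r0.
have [|B Bh Bc] := Hr n h (majority A).
  move=> x hx; rewrite err_majority //; have := Ah x hx.
  have : 0 <= err A h x by apply: sumr_ge0 => s _; apply: prob_ge0.
  move: (err A h x) => e e0 e1.
  have -> : 2^-1 - de' = 3 * (2^-1 - de) ^+ 2 - 2 * (2^-1 - de) ^+ 3.
    by rewrite /de'; field.
  set e' := 2^-1 - de in e1 *.
  have e'2 : e' <= 2^-1 by rewrite /e'; lra.
  (* Monotonicity of 3e^2 - 2e^3 below 1/2, by factoring out [e' - e]. *)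
  rewrite -subr_ge0.
  have -> : 3 * e' ^+ 2 - 2 * e' ^+ 3 - (3 * e ^+ 2 - 2 * e ^+ 3) =
    (e' - e) * (3 * (e + e') - 2 * (e ^+ 2 + e * e' + e' ^+ 2)) by ring.
  apply: mulr_ge0; nra.
exists B => //; apply: (leq_trans Bc).
by rewrite -mulnA leq_mul2l cost_majority orbT.
Qed.

(** * Hard distributions *)

Definition pospart (K : realType) (u : K) : K := Num.max 0 u.

Lemma pospart_ge0 (K : realType) (u : K) : 0 <= pospart u.
Proof. by rewrite /pospart le_max lexx. Qed.

(** The right-hand side is the square of [pospart u + v]. It is kept expanded because the cross term
    is what a good reply makes nonpositive in sum. *)
Lemma pospartD_sqr (K : realType) (u v : K) :
  pospart (u + v) ^+ 2 <= pospart u ^+ 2 + 2 * (pospart u * v) + v ^+ 2.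
Proof. by rewrite /pospart; case: (leP 0 u); case: (leP 0 (u + v)); nra. Qed.

(* Playing in each round a reply to the weights given by the positive parts of
   the accumulated losses, the sum of their squares grows by at most #|X| per
   round, so that the average losses tend to 0. *)
Lemma approx_minimax (K : realType) (X : finType) (Y : Type) (P : Y -> Prop)
    (a : X -> Y -> K) (eta : K) : 0 < eta ->
  (forall x y, `|a x y| <= 1) ->
  (forall w : X -> K, (forall x, 0 <= w x) ->
     exists2 y, P y & \sum_x w x * a x y <= 0) ->
  exists N (y : 'I_N.+1 -> Y), (forall i, P (y i)) /\
    forall x, \sum_i a x (y i) <= eta * N.+1%:R.
Proof.
move=> eta0 a1 win.
have run N : exists y : 'I_N -> Y, (forall i, P (y i)) /\
    \sum_x pospart (\sum_i a x (y i)) ^+ 2 <= N%:R * #|X|%:R.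
  elim: N => [|N [y [Py IH]]].
    have [y0 _ _] := win (fun=> 0) (fun=> lexx 0).
    exists (fun=> y0); split=> [[]//|]; rewrite mul0r big1 // => x _.
    by rewrite big_ord0 /pospart maxxx expr0n.
  have [z Pz zle] := win (fun x => pospart (\sum_i a x (y i)))
    (fun x => pospart_ge0 _).
  (* The new reply is appended at the last index. *)
  exists (fun i => if unlift ord_max i is Some j then y j else z); split.
    by move=> i; case: unliftP.
  have sumE x : \sum_(i < N.+1)
      a x (if unlift ord_max i is Some j then y j else z) =
      \sum_i a x (y i) + a x z.
    rewrite big_ord_recr /= unlift_none; congr (_ + _); apply: eq_bigr => i _.
    have -> : widen_ord (leqnSn N) i = lift ord_max i.
      by apply/val_inj; rewrite /= /bump leqNgt ltn_ord.
    by rewrite liftK.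
  apply: (@le_trans _ _ (\sum_x (pospart (\sum_i a x (y i)) ^+ 2 +
     2 * (pospart (\sum_i a x (y i)) * a x z) + 1))).
    apply: ler_sum => x _; rewrite sumE.
    apply: (le_trans (pospartD_sqr _ _)); rewrite lerD2l.
    by rewrite -real_normK ?num_real // expr_le1.
  rewrite !big_split /= -mulr_sumr sumr_const -natr1 mulrDl mul1r.
  by move: zle IH; lra.
(* After N+1 rounds each loss is at most the square root of (N+1)|X|; this choice of N makes it at
   most eta (N+1). *)
have [N NE] : exists N : nat, #|X|%:R <= eta ^+ 2 * N.+1%:R.
  exists (Num.bound (#|X|%:R / eta ^+ 2)).
  move: (Num.bound _) (archi_boundP (divr_ge0 (ler0n K #|X|)
    (exprn_ge0 2 (ltW eta0)))) => N; rewrite ltr_pdivrMr ?exprn_gt0 // => lN.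
  rewrite mulrC; apply: (le_trans (ltW lN)).
  by rewrite ler_wpM2r ?exprn_ge0 ?ltW // ltr_nat.
have [y [Py ly]] := run N.+1; exists N, y; split=> // x.
set u := \sum_i _.
have u_pos : u <= pospart u by rewrite /pospart le_max lexx orbT.
apply: (le_trans u_pos); have p0 := pospart_ge0 u.
have le1 : pospart u ^+ 2 <= N.+1%:R * #|X|%:R.
  apply: le_trans ly; rewrite (bigD1 x) //= lerDl.
  by apply: sumr_ge0 => i _; rewrite exprn_ge0 ?pospart_ge0.
have le2 : N.+1%:R * #|X|%:R <= (eta * N.+1%:R) ^+ 2.
  have := ler_wpM2l (ler0n K N.+1) NE; rewrite exprMn [N.+1%:R ^+ 2]expr2; lra.
have etaN0 : 0 <= eta * N.+1%:R by rewrite mulr_ge0 // ltW.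
by rewrite -(@ler_pXn2r _ 2) ?nnegrE // (le_trans le1 le2).
Qed.

Section HardDistribution.
Variables (K : realType) (m : nat) (g : pbool m).

(** Otherwise every weighting has a good reply of depth [d], and [approx_minimax] with accuracy
    [eta / 2] gives trees whose uniform mixture errs at most [2^-1 - eta / 2] everywhere on the
    domain at cost at most [d]. The weights need no normalization: strictness already forces a
    positive total. *)
Lemma hard_weights (d : nat) (eta : K) : 0 < eta <= 2^-1 ->
  (forall A : ralg K m,
     (forall x, g x != None -> err A g x <= 2^-1 - eta / 2) ->
     (d < cost A)%N) ->
  exists w : bits m -> K, (forall x, 0 <= w x) /\
    forall t : dtree m, (forall x, (queries t x <= d)%N) ->
    \sum_(x | g x != None) w x * (Some (eval t x) == g x)%:R <
    (2^-1 + eta) * \sum_(x | g x != None) w x.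
Proof.
move=> /andP[eta0 eta1] noA.
pose a x t : K := if g x == None then 0
  else 2^-1 + eta - (Some (eval t x) == g x)%:R.
apply: contrapT => nohard.
have a1 x t : `|a x t| <= 1.
  rewrite /a; case: ifP; rewrite ?normr0 // => _.
  by rewrite ler_norml; case: (Some _ == _) => /=; apply/andP; split; lra.
have e2 : 0 < eta / 2 by rewrite divr_gt0.
have [w w0|N [t [td ta]]] := approx_minimax
    (P := fun t => forall x, (queries t x <= d)%N) e2 a1.
  apply: contrapT => not; apply: nohard; exists w; split=> // t td.
  rewrite ltNge; apply/negP => le; apply: not; exists t => //.
  apply: (@le_trans _ _ ((2^-1 + eta) * (\sum_(x | g x != None) w x) -
    \sum_(x | g x != None) w x * (Some (eval t x) == g x)%:R)); last first.
    by rewrite subr_le0.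
  rewrite mulr_sumr -sumrB [leRHS]big_mkcond /=; apply: ler_sum => x _.
  by rewrite /a; case: ifP => /= _; rewrite ?mulr0 // mulrBr mulrC.
have N0 : N.+1%:R != 0 :> K by rewrite pnatr_eq0.
have p0 (i : 'I_N.+1) : 0 <= N.+1%:R^-1 :> K by rewrite invr_ge0.
have p1 : \sum_(i < N.+1) N.+1%:R^-1 = 1 :> K.
  by rewrite sumr_const card_ord -[LHS]mulr_natr mulVf.
pose A := RAlg p0 p1 t.
suff : (d < cost A)%N by rewrite ltnNge cost_le.
apply: noA => x hx; rewrite err_expect /expect /= -mulr_sumr ler_pdivrMl ?ltr0n //.
have := ta x; rewrite (eq_bigr (fun i => eta - 2^-1 +
    (Some (eval (t i) x) != g x)%:R)); last first.
  by move=> i _; rewrite /a (negPf hx); case: eqP => _ /=; field.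
rewrite big_split /= sumr_const card_ord -[(eta - _) *+ _]mulr_natr.
by clear; lra.
Qed.
End HardDistribution.

Lemma sum_set_split (V : nmodType) (I : finType) (i : I) (F : {set I} -> V) :
  \sum_(S : {set I}) F S =
  \sum_(S : {set I} | i \notin S) (F S + F (i |: S)%SET).
Proof.
rewrite (bigID (fun S : {set I} => i \notin S)) /= big_split /=; congr (_ + _).
rewrite (reindex_onto (fun S => i |: S)%SET (fun S => S :\ i)%SET) /=; last first.
  by move=> S; rewrite negbK => iS; rewrite finset.setD1K.
apply: eq_bigl => S; rewrite negbK finset.setU11 /=.
apply/eqP/idP => [<-|iS]; first by rewrite !inE eqxx.
by rewrite finset.setU1K.
Qed.

(** * Lazy simulation of a tree for the composition *)

Section Simulation.
Variables (K : realType) (n m : nat) (bst : Type).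
Variables (next : 'I_m -> bool -> bst -> bst) (P : bool -> bst -> K).
Variable common : bst -> K.
Hypothesis P_next :
  forall j b s, P b s = P b (next j false s) + P b (next j true s).
Hypothesis common_ge0 : forall s, 0 <= common s.
Hypothesis common_le : forall b s, common s <= P b s.
Hypothesis common_next :
  forall j s, common (next j false s) + common (next j true s) <= common s.

(** [P b s] stands for the probability that a block drawn for the bit [b] gives the answers recorded
    in [s]. Along a read [P] is conserved while [common] may drop; what it loses passes into the
    excess. *)
Definition excess b s := P b s - common s.

Lemma excess_ge0 b s : 0 <= excess b s.
Proof. by rewrite subr_ge0. Qed.

Definition unindex (q : 'I_(n * m)) : 'I_n * 'I_m :=
  enum_val (cast_ord (esym (mxvec_cast n m)) q).

Definition state := 'I_n -> bst.

Definition step (q : 'I_(n * m)) (a : bool) (st : state) : state :=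
  fun i => if i == (unindex q).1 then next (unindex q).2 a (st i) else st i.

(** All leaves are summed without an input: the probability of reaching a leaf is part of [F], as a
    function of the final state. *)
Fixpoint leafsum (t : dtree (n * m)) (st : state) (F : bool -> state -> K) :
    K :=
  match t with
  | Leaf b => F b st
  | Query q t0 t1 =>
      leafsum t0 (step q false st) F + leafsum t1 (step q true st) F
  end.

Definition learn (k : {ffun 'I_n -> option bool}) i b :=
  [ffun j => if j == i then Some b else k j].

(* Runs a tree for [f o g] on an input whose blocks are only sampled as far as
   they have been read.  As long as the bit [z i] has not been asked, the state
   [s] of block [i] carries the mass [common s], which does not depend on [z i];
   once it has been asked, the state carries the remaining [excess (z i) s]. *)
Fixpoint simulate (t : dtree (n * m)) (st : state)
    (k : {ffun 'I_n -> option bool}) : ralg K n :=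
  match t with
  | Leaf b => deterministic K (Leaf b)
  | Query q t0 t1 =>
      let i := (unindex q).1 in
      let s0 := step q false st i in
      let s1 := step q true st i in
      let go b := coin (excess b s1 / (excess b s0 + excess b s1))
        (simulate t1 (step q true st) (learn k i b))
        (simulate t0 (step q false st) (learn k i b)) in
      if k i is Some b then go b else
        coin ((common s0 + common s1) / common (st i))
          (coin (common s1 / (common s0 + common s1))
             (simulate t1 (step q true st) k) (simulate t0 (step q false st) k))
          (ask i (go false) (go true))
  end.

Definition known (z : bits n) (S : {set 'I_n}) : {ffun 'I_n -> option bool} :=
  [ffun i => if i \in S then Some (z i) else None].

Lemma learn_known z S i : learn (known z S) i (z i) = known z (i |: S)%SET.
Proof. by apply/ffunP => j; rewrite !ffunE !inE; case: eqP => [->|]. Qed.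

(** The probability that the simulation for [z] is in state [st] having asked exactly the bits in
    [S]. *)
Definition mass (z : bits n) (st : state) (S : {set 'I_n}) : K :=
  \prod_i (if i \in S then excess (z i) (st i) else common (st i)).

Lemma ratio01 (a b : K) : 0 <= a -> 0 <= b -> 0 <= a / (b + a) <= 1.
Proof.
move=> a0 b0; rewrite divr_ge0 ?addr_ge0 //=.
have [->|ba] := eqVneq (b + a) 0; first by rewrite invr0 mulr0 ler01.
by rewrite ler_pdivrMr ?mul1r ?lerDr // lt_neqAle eq_sym ba addr_ge0.
Qed.

(** Mass balance of one read: [M], [m0], [m1] are common masses before and after, the [Q]s excesses,
    and [X], [Y] the values of the continuations with the bit unasked and asked. The share
    [M - (m0 + m1)] that triggers a query joins [Q], and together they supply [Q0 + Q1]. *)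
Lemma split_mass_flow (M m0 m1 Q Q0 Q1 X0 X1 Y0 Y1 : K) :
  0 <= m0 -> 0 <= m1 -> m0 + m1 <= M -> 0 <= Q0 -> 0 <= Q1 ->
  Q + M = Q0 + Q1 + m0 + m1 ->
  let Y := Q1 / (Q0 + Q1) * Y1 + (1 - Q1 / (Q0 + Q1)) * Y0 in
  M * ((m0 + m1) / M * (m1 / (m0 + m1) * X1 + (1 - m1 / (m0 + m1)) * X0) +
       (1 - (m0 + m1) / M) * Y) + Q * Y =
  (m0 * X0 + Q0 * Y0) + (m1 * X1 + Q1 * Y1).
Proof.
move=> m00 m10 mM Q00 Q10 QM Y.
(* If the denominator vanishes, both nonnegative masses do, so the arbitrary coin is harmless. *)
have cancel (a b u v : K) : 0 <= a -> 0 <= b ->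
    (a + b) * (b / (a + b) * v + (1 - b / (a + b)) * u) = a * u + b * v.
  move=> a0 b0; have [ab0|ab] := eqVneq (a + b) 0; last by field.
  by move/eqP: ab0; rewrite paddr_eq0 // => /andP[/eqP-> /eqP->]; ring.
have -> : M * ((m0 + m1) / M *
         (m1 / (m0 + m1) * X1 + (1 - m1 / (m0 + m1)) * X0) +
       (1 - (m0 + m1) / M) * Y) = (m0 * X0 + m1 * X1) + (M - (m0 + m1)) * Y.
  rewrite -cancel //; move: (m1 / (m0 + m1) * X1 + _) => E.
  have [M0|M0] := eqVneq M 0; last by field.
  have : m0 + m1 == 0 by rewrite eq_le -{1}M0 mM addr_ge0.
  by rewrite paddr_eq0 // => /andP[/eqP-> /eqP->]; rewrite M0; ring.
have -> : Q0 * Y0 = Q0 * Y0 + Q1 * Y1 - Q1 * Y1 by ring.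
rewrite -[Q0 * Y0 + _]cancel // -/Y.
have -> : Q = Q0 + Q1 + m0 + m1 - M by rewrite -QM addrK.
ring.
Qed.

Lemma mass_split z (st : state) (S : {set 'I_n}) i : i \notin S ->
  exists R, forall st', (forall j, j != i -> st' j = st j) ->
    mass z st' S = R * common (st' i) /\
    mass z st' (i |: S)%SET = R * excess (z i) (st' i).
Proof.
move=> iS.
exists (\prod_(j | j != i)
  (if j \in S then excess (z j) (st j) else common (st j))).
move=> st' st'E; rewrite /mass (bigD1 i) //= [X in _ /\ X = _](bigD1 i) //=.
rewrite finset.setU11 (negPf iS).
split; rewrite mulrC; congr (_ * _); apply: eq_bigr => j ji; rewrite st'E //.
by rewrite finset.in_setU1 (negPf ji).
Qed.

Lemma step_neq q a st j : j != (unindex q).1 -> step q a st j = st j.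
Proof. by rewrite /step => /negPf ->. Qed.

Lemma step_eq q a st :
  step q a st (unindex q).1 = next (unindex q).2 a (st (unindex q).1).
Proof. by rewrite /step eqxx. Qed.

(** Starting from the mixture of all sets of asked bits with weights [mass], the same invariant
    holds at every leaf. The total count is the size of [S] plus the queries still to come. *)
Lemma expect_simulate t st z F :
  \sum_(S : {set 'I_n}) mass z st S *
     expect (simulate t st (known z S)) z (fun b q => F b (#|S| + q)%N) =
  leafsum t st (fun b st' => \sum_(S : {set 'I_n}) mass z st' S * F b #|S|).
Proof.
elim: t st => [b|q t0 IH0 t1 IH1] st /=.
  by apply: eq_bigr => S _; rewrite expect_deterministic addn0.
(* Only the status of the block being read can change, so the sets are paired with and without
   it. *)
rewrite -IH0 -IH1 -big_split /= !(sum_set_split (unindex q).1).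
apply: eq_bigr => S iS; set i := (unindex q).1 in iS *.
have [R HR] := mass_split z st iS.
have [-> ->] := HR st (fun _ _ => erefl).
have [-> ->] := HR _ (@step_neq q false st).
have [-> ->] := HR _ (@step_neq q true st).
rewrite !ffunE (negPf iS) finset.setU11 cardsU1 iS.
set s0 := step q false st i; set s1 := step q true st i.
have m_le : common s0 + common s1 <= common (st i).
  by rewrite /s0 /s1 !step_eq common_next.
have p01 : 0 <= (common s0 + common s1) / common (st i) <= 1.
  rewrite divr_ge0 ?addr_ge0 //=; have [->|M0] := eqVneq (common (st i)) 0.
    by rewrite invr0 mulr0 ler01.
  by rewrite ler_pdivrMr ?mul1r // lt_neqAle eq_sym M0 common_ge0.
rewrite !expect_coin ?expect_ask ?ratio01 ?excess_ge0 //.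
have -> : (if z i then coin (excess true s1 / (excess true s0 + excess true s1))
        (simulate t1 (step q true st) (learn (known z S) i true))
        (simulate t0 (step q false st) (learn (known z S) i true))
   else coin (excess false s1 / (excess false s0 + excess false s1))
        (simulate t1 (step q true st) (learn (known z S) i false))
        (simulate t0 (step q false st) (learn (known z S) i false))) = 
   coin (excess (z i) s1 / (excess (z i) s0 + excess (z i) s1))
        (simulate t1 (step q true st) (known z (i |: S)%SET))
        (simulate t0 (step q false st) (known z (i |: S)%SET)).
  by rewrite -learn_known; case: (z i).
rewrite expect_coin ?ratio01 ?excess_ge0 // learn_known finset.setUA finset.setUid.
(* The query just made is charged to the enlarged set; [true] is the increment of its
   cardinality. *)
have -> : (fun b q' => F b (#|S| + q'.+1)%N) =
    (fun b q' => F b (true + #|S| + q')%N).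
  by apply/funext => b; apply/funext => q'; rewrite addnAC addnC.
rewrite -!(mulrA R) -!(mulrDr R) split_mass_flow ?common_ge0 ?excess_ge0 //.
  by congr (_ * _); rewrite addrACA.
rewrite /excess /s0 /s1 !step_eq; have := P_next (unindex q).2 (z i) (st i).
by rewrite -/i; lra.
Qed.

Lemma sum_mass z st :
  \sum_(S : {set 'I_n}) mass z st S = \prod_i P (z i) (st i).
Proof.
rewrite -bigA_distr; apply: eq_bigr => i _ /=.
by rewrite /excess subrK.
Qed.

Lemma sum_mass_card z st :
  \sum_(S : {set 'I_n}) mass z st S * #|S|%:R =
  \sum_i excess (z i) (st i) * \prod_(j | j != i) P (z j) (st j).
Proof.
transitivity (\sum_(S : {set 'I_n}) \sum_i mass z st S * (i \in S)%:R).
  apply: eq_bigr => S _; rewrite -mulr_sumr -sum1_card natr_sum big_mkcond.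
  by congr (_ * _); apply: eq_bigr => i _; case: (i \in S).
rewrite exchange_big; apply: eq_bigr => i _ /=.
(* Removing the common mass of block [i] leaves exactly the sets containing [i], and the sum factors
   again. *)
pose c j := if j == i then 0 else common (st j).
transitivity (\sum_(S : {set 'I_n})
    \prod_j (if j \in S then excess (z j) (st j) else c j)).
  apply: eq_bigr => S _; rewrite /mass (bigD1 i) //= [RHS](bigD1 i) //=.
  rewrite /c eqxx; case: (i \in S); rewrite ?mulr0 ?mulr1 ?mul0r //.
  by congr (_ * _); apply: eq_bigr => j /negPf ->.
rewrite -bigA_distr (bigD1 i) //= /c eqxx addr0; congr (_ * _).
by apply: eq_bigr => j /negPf ->; rewrite /excess subrK.
Qed.

Lemma eq_leafsum t st F G : (forall b st', F b st' = G b st') ->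
  leafsum t st F = leafsum t st G.
Proof. by move=> FG; elim: t st => //= q t0 IH0 t1 IH1 st; rewrite IH0 IH1. Qed.

Lemma le_leafsum t st F G : (forall b st', F b st' <= G b st') ->
  leafsum t st F <= leafsum t st G.
Proof.
by move=> FG; elim: t st => //= q t0 IH0 t1 IH1 st; apply: lerD.
Qed.

Lemma leafsum_sum (I : finType) t st (F : I -> bool -> state -> K) :
  leafsum t st (fun b st' => \sum_i F i b st') = \sum_i leafsum t st (F i).
Proof.
by elim: t st => //= q t0 IH0 t1 IH1 st; rewrite IH0 IH1 big_split.
Qed.

Lemma leafsumD t st F G :
  leafsum t st (fun b st' => F b st' + G b st') =
  leafsum t st F + leafsum t st G.
Proof.
by elim: t st => //= q t0 IH0 t1 IH1 st; rewrite IH0 IH1 addrACA.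
Qed.

Lemma prod_step (A : pred 'I_n) q z st : A (unindex q).1 ->
  \prod_(i | A i) P (z i) (st i) =
  \prod_(i | A i) P (z i) (step q false st i) +
  \prod_(i | A i) P (z i) (step q true st i).
Proof.
move=> Aq; rewrite !(bigD1 (unindex q).1 Aq) /= !step_eq.
rewrite (P_next (unindex q).2 (z (unindex q).1)) mulrDl.
by congr (_ * _ + _ * _); apply: eq_bigr => i /andP[_ iq]; rewrite step_neq.
Qed.

Lemma prod_step_out (A : pred 'I_n) q a z st : ~~ A (unindex q).1 ->
  \prod_(i | A i) P (z i) (step q a st i) = \prod_(i | A i) P (z i) (st i).
Proof.
move=> Aq; apply: eq_bigr => i Ai; rewrite step_neq //.
by apply: contraNneq Aq => <-.
Qed.

End Simulation.

(** * Blocks drawn from a pair of distributions *)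

Section Blocks.
Variables (K : realType) (n m d : nat) (mu : bool -> bits m -> K).
Hypothesis mu_ge0 : forall b x, 0 <= mu b x.

Definition weight b (C : {set bits m}) : K := \sum_x mu b x * (x \in C)%:R.

Definition fix_bit (C : {set bits m}) j a :=
  [set x : bits m in C | x j == a]%SET.

Lemma in_fix_bit C j a x : (x \in fix_bit C j a) = (x \in C) && (x j == a).
Proof. by rewrite inE. Qed.

(** The state holds the block inputs consistent with the answers and the number of reads, repeated
    reads included. *)
Definition block_next (j : 'I_m) (a : bool) (s : {set bits m} * nat) :=
  (fix_bit s.1 j a, s.2.+1).

Definition overlap (C : {set bits m}) : K :=
  Num.min (weight false C) (weight true C).

Definition block_weight b (s : {set bits m} * nat) : K := weight b s.1.

(* After d reads the bit of the block is asked, as no common mass is left. *)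
Definition block_common (s : {set bits m} * nat) : K :=
  if (s.2 <= d)%N then overlap s.1 else 0.

Lemma weight_split b (j : 'I_m) (C : {set bits m}) : weight b C =
  weight b (fix_bit C j false) + weight b (fix_bit C j true).
Proof.
rewrite /weight -big_split; apply: eq_bigr => x _ /=.
rewrite -mulrDr !in_fix_bit.
by case: (x \in C); case: (x j); rewrite ?addr0 ?add0r.
Qed.

Lemma weight_ge0 b C : 0 <= weight b C.
Proof. by apply: sumr_ge0 => x _; rewrite mulr_ge0. Qed.

Lemma overlap_ge0 C : 0 <= overlap C.
Proof. by rewrite /overlap le_min !weight_ge0. Qed.

Lemma overlap_le b C : overlap C <= weight b C.
Proof. by rewrite /overlap; case: b; rewrite ge_min lexx ?orbT. Qed.

Lemma overlap_split (j : 'I_m) C :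
  overlap (fix_bit C j false) + overlap (fix_bit C j true)
  <= overlap C.
Proof.
rewrite {3}/overlap le_min !(weight_split _ j C).
by rewrite !lerD ?overlap_le.
Qed.

Lemma block_weight_next j b s : block_weight b s =
  block_weight b (block_next j false s) + block_weight b (block_next j true s).
Proof. exact: weight_split. Qed.

Lemma block_common_ge0 s : 0 <= block_common s.
Proof. by rewrite /block_common; case: ifP; rewrite ?overlap_ge0. Qed.

Lemma block_common_le b s : block_common s <= block_weight b s.
Proof. by rewrite /block_common; case: ifP; rewrite ?overlap_le ?weight_ge0. Qed.

Lemma block_common_next j s :
  block_common (block_next j false s) + block_common (block_next j true s)
  <= block_common s.
Proof.
rewrite /block_common /=; case: ltnP => sd; last first.
  by rewrite addr0; apply: block_common_ge0.
by rewrite ltnW // overlap_split.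
Qed.

(** For probability distributions and full [C], this is one minus the total variation distance of
    the two leaf distributions. *)
Fixpoint tree_overlap (u : dtree m) (C : {set bits m}) : K :=
  match u with
  | Leaf _ => overlap C
  | Query j u0 u1 => tree_overlap u0 (fix_bit C j false) +
                     tree_overlap u1 (fix_bit C j true)
  end.

Definition flat (x : {ffun 'I_n -> bits m}) : bits (n * m) :=
  [ffun q => x (unindex q).1 (unindex q).2].

Lemma unindex_index i j : @unindex n m (mxvec_index i j) = (i, j).
Proof. by rewrite /unindex /mxvec_index cast_ordK enum_rankK. Qed.

Lemma block_flat x i : block (flat x) i = x i.
Proof. by apply/ffunP => j; rewrite !ffunE unindex_index. Qed.

Let bstate := state n ({set bits m} * nat).

Definition reads (st : bstate) : nat := (\sum_i (st i).2)%N.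

Lemma reads_step q a st : reads (step block_next q a st) = (reads st).+1.
Proof.
rewrite /reads (bigD1 (unindex q).1) //= step_eq /=.
rewrite [in RHS](bigD1 (unindex q).1) //=.
by rewrite addSn; congr (_ + _).+1; apply: eq_bigr => i iq; rewrite step_neq.
Qed.

Definition input_weight (z : bits n) (x : {ffun 'I_n -> bits m}) : K :=
  \prod_i mu (z i) (x i).

(** Exchanges leaves and inputs: each input consistent with the initial state reaches exactly one
    leaf, where the product of block weights counts it. *)
Lemma leafsum_input t (st : bstate) (z : bits n) (h : bool -> nat -> K) :
  leafsum block_next t st
    (fun b st' => (\prod_i block_weight (z i) (st' i)) * h b (reads st'))
  =
  \sum_x input_weight z x * [forall i, x i \in (st i).1]%:R *
    h (eval t (flat x)) (reads st + queries t (flat x))%N.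
Proof.
elim: t st => [b|q t0 IH0 t1 IH1] st /=.
  rewrite bigA_distr_bigA /= mulr_suml addn0; apply: eq_bigr => x _.
  congr (_ * _); rewrite big_split /=; congr (_ * _).
  case: forallP => [all|/forallP/forallPn[i /negPf iF]].
    by rewrite big1 // => i _; rewrite all.
  by rewrite (bigD1 i) //= iF mul0r.
rewrite IH0 IH1 -big_split; apply: eq_bigr => x _ /=.
rewrite !reads_step addnS !addSn ffunE -/(flat x).
have E a : [forall i, x i \in (step block_next q a st i).1] =
    [forall i, x i \in (st i).1] && (x (unindex q).1 (unindex q).2 == a).
  apply/forallP/andP => [all|[/forallP all xa] i].
    split; last first.
      by have := all (unindex q).1; rewrite step_eq in_fix_bit => /andP[].
    apply/forallP => i; have := all i.
    have [->|iq] := eqVneq i (unindex q).1; last by rewrite step_neq.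
    by rewrite step_eq in_fix_bit => /andP[].
  have [->|iq] := eqVneq i (unindex q).1; last by rewrite step_neq.
  by rewrite step_eq in_fix_bit all.
rewrite !E; case: (x _ _); case: [forall _, _];
  by rewrite ?mulr0 ?mul0r ?addr0 ?add0r.
Qed.

Lemma leafsum_far t (st : bstate) (z : bits n) i : (d < (st i).2)%N ->
  leafsum block_next t st (fun _ st' => (if ((st' i).2 <= d)%N then
    weight (z i) (st' i).1 - overlap (st' i).1 else 0) *
    \prod_(j | j != i) block_weight (z j) (st' j)) = 0.
Proof.
elim: t st => [b|q t0 IH0 t1 IH1] st dst /=; first by rewrite leqNgt dst mul0r.
have far a : (d < (step block_next q a st i).2)%N.
  rewrite /step; case: eqP => //= _; exact: ltnW.
by rewrite IH0 // IH1 // addr0.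
Qed.

(* Averaging over the other blocks: their best values turn [t] into a tree on
   block [i] alone. *)
Lemma leafsum_block t (st : bstate) (z : bits n) i : ((st i).2 <= d)%N ->
  exists2 u : dtree m, (forall y, (queries u y <= d - (st i).2)%N) &
  leafsum block_next t st (fun _ st' => (if ((st' i).2 <= d)%N then
    weight (z i) (st' i).1 - overlap (st' i).1 else 0) *
    \prod_(j | j != i) block_weight (z j) (st' j)) <=
  (weight (z i) (st i).1 - tree_overlap u (st i).1) *
    \prod_(j | j != i) block_weight (z j) (st j).
Proof.
elim: t st => [b|q t0 IH0 t1 IH1] st std /=.
  by exists (Leaf false) => //=; rewrite std.
have prod_ge0 st' : 0 <= \prod_(j | j != i) block_weight (z j) (st' j).
  by apply: prodr_ge0 => j _; apply: weight_ge0.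
(* A read elsewhere leaves block [i] alone, and the subtree of smaller overlap gives a bound valid
   for both answers. *)
have [qi|qi] := eqVneq (unindex q).1 i; last first.
  have sti a : step block_next q a st i = st i by rewrite step_neq // eq_sym.
  have [|u0 u0d le0] := IH0 (step block_next q false st); first by rewrite sti.
  have [|u1 u1d le1] := IH1 (step block_next q true st); first by rewrite sti.
  rewrite !sti in u0d u1d le0 le1.
  have prodE := prod_step block_weight_next z st (A := fun j => j != i) qi.
  have [ov|/ltW ov] := leP (tree_overlap u0 (st i).1)
    (tree_overlap u1 (st i).1).
    exists u0 => //; apply: (le_trans (lerD le0 le1)).
    rewrite prodE mulrDr lerD2l.
    by rewrite ler_wpM2r // lerD2l lerN2.
  exists u1 => //; apply: (le_trans (lerD le0 le1)).
  rewrite prodE mulrDr lerD2r.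
  by rewrite ler_wpM2r // lerD2l lerN2.
have sti a : step block_next q a st i = block_next (unindex q).2 a (st i).
  by rewrite -qi step_eq.
have prodE a :
    \prod_(j | j != i) block_weight (z j) (step block_next q a st j) =
    \prod_(j | j != i) block_weight (z j) (st j).
  by rewrite prod_step_out // negbK qi.
(* With [d] reads already made, this read makes all later terms vanish, so any leaf serves as
   [u]. *)
have [ltd|led] := ltnP (st i).2 d; last first.
  exists (Leaf false) => //=.
  by rewrite !leafsum_far ?sti //= addr0 mulr_ge0 // subr_ge0 overlap_le.
have [|u0 u0d le0] := IH0 (step block_next q false st); first by rewrite sti.
have [|u1 u1d le1] := IH1 (step block_next q true st); first by rewrite sti.
rewrite !sti in u0d u1d le0 le1.
exists (Query (unindex q).2 u0 u1) => [y /=|].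
  rewrite subnS in u0d u1d.
  have dst : (0 < d - (st i).2)%N by rewrite subn_gt0.
  by rewrite -(prednK dst) ltnS; case: (y _).
apply: (le_trans (lerD le0 le1)); rewrite !prodE -mulrDl ler_wpM2r //=.
by rewrite (weight_split (z i) (unindex q).2 (st i).1); lra.
Qed.

End Blocks.

(** The pair consists of the hard weights conditioned on the value of [g]. If the two leaf
    distributions of a shallow tree overlapped little, labelling its leaves by maximum likelihood
    would predict [g] too well. *)
Lemma hard_pair (K : realType) m (g : pbool m) (d : nat) (eta : K) :
  0 < eta <= 4^-1 ->
  (forall A : ralg K m,
     (forall x, g x != None -> err A g x <= 2^-1 - eta / 2) ->
     (d < cost A)%N) ->
  exists mu : bool -> bits m -> K, [/\ forall b x, 0 <= mu b x,
    forall b, \sum_x mu b x = 1, forall b x, g x != Some b -> mu b x = 0 &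
    forall u, (forall y, (queries u y <= d)%N) ->
      1 - 4 * eta <= tree_overlap mu u [set: bits m]%SET].
Proof.
move=> /andP[eta0 eta4] noA.
have [|w [w0 hard]] := hard_weights _ noA; first by rewrite eta0 /=; lra.
pose M (b : bool) (C : {set bits m}) : K :=
  \sum_x (if g x == Some b then w x else 0) * (x \in C)%:R.
pose W := \sum_(x | g x != None) w x.
have M_split b j C : M b C = M b (fix_bit C j false) + M b (fix_bit C j true).
  rewrite /M -big_split; apply: eq_bigr => x _ /=; rewrite -mulrDr !in_fix_bit.
  by case: (x \in C); case: (x j); rewrite ?addr0 ?add0r.
pose score u (C : {set bits m}) : K :=
  \sum_(x | g x != None) w x * (Some (eval u x) == g x)%:R *
  (x \in C)%:R.
have score_leaf b C : score (Leaf b) C = M b C.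
  rewrite /score big_mkcond; apply: eq_bigr => x _ /=.
  rewrite [Some b == _]eq_sym; case: (g x) => [a|] /=; last by rewrite mul0r.
  by case: ifP => _; rewrite ?mulr1 // mulr0 !mul0r.
have score_query j u0 u1 C : score (Query j u0 u1) C =
    score u0 (fix_bit C j false) + score u1 (fix_bit C j true).
  rewrite /score -big_split; apply: eq_bigr => x _ /=; rewrite !in_fix_bit.
  by case: (x j); rewrite ?andbF ?andbT mulr0 ?addr0 ?add0r.
(* Constant trees cannot predict [g] well either, so both classes are nearly balanced and of
   positive weight. *)
have MT b : M b [set: bits m]%SET < (2^-1 + eta) * W.
  have := hard (Leaf b) (fun=> leq0n d); rewrite -score_leaf /score.
  by under [X in _ -> X < _]eq_bigr => x _ do rewrite inE mulr1.
have WE : W = M false [set: bits m]%SET + M true [set: bits m]%SET.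
  rewrite /W /M -big_split big_mkcond; apply: eq_bigr => x _ /=.
  by rewrite inE !mulr1; case: (g x) => [[]|] /=; rewrite ?addr0 ?add0r.
have M0 b C : 0 <= M b C.
  by apply: sumr_ge0 => x _; rewrite mulr_ge0 //; case: ifP.
have W0 : 0 < W by have := MT true; have := M0 true [set: bits m]%SET; nra.
have MT0 b : 0 < M b [set: bits m]%SET.
  have := MT (~~ b); case: b; rewrite /=; nra.
pose mu (b : bool) x : K :=
  (if g x == Some b then w x else 0) / M b [set: bits m]%SET.
have weightE b C : weight mu b C = M b C / M b [set: bits m]%SET.
  by rewrite /weight /M mulr_suml; apply: eq_bigr => x _; rewrite mulrAC.
(* The maximum likelihood decision at each leaf. *)
pose label := fix label u C : dtree m := match u with
  | Leaf _ => Leaf (M false C <= M true C)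
  | Query j u0 u1 => Query j (label u0 (fix_bit C j false))
                             (label u1 (fix_bit C j true))
  end.
have label_queries u C y : queries (label u C) y = queries u y.
  by elim: u C => //= j u0 IH0 u1 IH1 C; rewrite IH0 IH1.
(* A labelled leaf errs on the smaller of the two masses, and by [MT] each mass is at most
   [(2^-1 + eta) * W] times its conditional weight. *)
have main u C : M false C + M true C <=
    score (label u C) C + (2^-1 + eta) * W * tree_overlap mu u C.
  elim: u C => [b|j u0 IH0 u1 IH1] C /=; last first.
    have := IH0 (fix_bit C j false); have := IH1 (fix_bit C j true).
    rewrite score_query (M_split false j C) (M_split true j C); lra.
  have ov b' : M b' C <= (2^-1 + eta) * W * weight mu b' C.
    have -> : M b' C = M b' [set: bits m]%SET * weight mu b' C.
      by rewrite weightE mulrCA mulfV ?mulr1 // gt_eqF.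
    by apply: ler_wpM2r; [rewrite weightE divr_ge0 ?M0|exact: ltW].
  rewrite score_leaf /overlap; have ov0 := ov false; have ov1 := ov true.
  case: (leP (M false C) (M true C)) => MM;
    case: (leP (weight mu false C) (weight mu true C)) => ww; lra.
exists mu; split.
- by move=> b x; rewrite divr_ge0 //; case: ifP.
- move=> b; transitivity (weight mu b [set: bits m]%SET).
    by apply: eq_bigr => x _; rewrite inE mulr1.
  by rewrite weightE mulfV // gt_eqF.
- by move=> b x /negPf gx; rewrite /mu gx mul0r.
move=> u ud; have := main u [set: bits m]%SET.
have : score (label u [set: bits m]%SET) [set: bits m]%SET < (2^-1 + eta) * W.
  have := hard (label u [set: bits m]%SET); rewrite /score.
  under [X in _ -> X < _]eq_bigr => x _ do rewrite inE mulr1.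
  by apply => x; rewrite label_queries.
rewrite -WE; move: (tree_overlap _ _ _) => v sc le.
have le1 : (2^-1 - eta) * W <= (2^-1 + eta) * v * W by lra.
rewrite ler_pM2r // in le1.
(* (1/2 + eta)(1 - 4 eta) = 1/2 - eta - 4 eta^2 is at most 1/2 - eta. *)
by rewrite -(@ler_pM2l _ (2^-1 + eta)); nra.
Qed.

(** * Simulation on blocks from a hard pair *)

Section Core.
Variables (K : realType) (n m d : nat) (mu : bool -> bits m -> K) (gamma : K).
Hypothesis mu_ge0 : forall b x, 0 <= mu b x.
Hypothesis mu_sum1 : forall b, \sum_x mu b x = 1.
Hypothesis mu_hard : forall u, (forall y, (queries u y <= d)%N) ->
  1 - gamma <= tree_overlap mu u [set: bits m]%SET.

Definition start : state n ({set bits m} * nat) :=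
  fun=> ([set: bits m]%SET, 0%N).

Definition simulation (t : dtree (n * m)) : ralg K n :=
  simulate (@block_next m) (block_weight mu) (block_common d mu) t start
    [ffun=> None].

Let weightT b : weight mu b [set: bits m]%SET = 1.
Proof. by rewrite -(mu_sum1 b); apply: eq_bigr => x _; rewrite inE mulr1. Qed.

(** At the start all mass is common, so of all sets of asked bits only the empty one has nonzero
    mass, namely 1. *)
Lemma expect_simulation t z F : expect (simulation t) z F =
  leafsum (@block_next m) t start (fun b st =>
    \sum_(S : {set 'I_n})
      mass (block_weight mu) (block_common d mu) z st S * F b #|S|).
Proof.
have commonT i : block_common d mu (start i) = 1.
  by rewrite /block_common /overlap /= !weightT minxx.
rewrite -(expect_simulate (block_weight_next mu) (block_common_ge0 d mu_ge0)
  (block_common_le d mu_ge0) (block_common_next d mu_ge0)).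
rewrite (bigD1 finset.set0) //= big1 => [|S S0]; last first.
  have /finset.set0Pn[i iS] := S0.
  rewrite /mass (bigD1 i) //= iS /excess commonT /block_weight weightT subrr.
  by rewrite !mul0r.
rewrite /mass big1 => [|i _]; last by rewrite inE commonT.
rewrite mul1r addr0 cards0; congr (expect (simulate _ _ _ _ _ _) _ _).
by apply/ffunP => i; rewrite !ffunE inE.
Qed.

Lemma sum_input_weight z : \sum_x @input_weight K n m mu z x = 1.
Proof.
by rewrite -(bigA_distr_bigA (fun i x => mu (z i) x)) big1.
Qed.

(** Summing [mass] over [S] restores the full block weights, so the simulated output has exactly the
    law of [t] on blocks drawn from [mu (z i)]. *)
Lemma simulation_output t z (h : bool -> K) :
  expect (simulation t) z (fun b _ => h b) =
  \sum_x @input_weight K n m mu z x * h (eval t (flat x)).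
Proof.
rewrite expect_simulation.
transitivity (leafsum (@block_next m) t start (fun b st =>
    (\prod_i block_weight mu (z i) (st i)) * h b)).
  by apply: eq_leafsum => b st; rewrite -mulr_suml sum_mass.
etransitivity; first exact: (leafsum_input mu t start z (fun b _ => h b)).
apply: eq_bigr => x _; congr (_ * _).
by rewrite (_ : [forall _, _]) ?mulr1 //; apply/forallP => i; rewrite inE.
Qed.

(** A block with at most [d] reads has been asked with the mass outside the overlap, in total at
    most [gamma] per block. A block with more reads counts fully, but there are at most [T / d.+1]
    of these. *)
Lemma simulation_queries t z T : (forall x, (queries t x <= T)%N) ->
  expect (simulation t) z (fun _ q => q%:R) <= gamma * n%:R + T%:R / d.+1%:R.
Proof.
move=> tT; rewrite expect_simulation.
pose early_excess i (st : state n ({set bits m} * nat)) :=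
  (if ((st i).2 <= d)%N then weight mu (z i) (st i).1 - overlap mu (st i).1
   else 0) *
    \prod_(j | j != i) block_weight mu (z j) (st j).
pose far i (st : state n ({set bits m} * nat)) :=
  (\prod_j block_weight mu (z j) (st j)) * (d < (st i).2)%:R.
rewrite (eq_leafsum _ _ _ (G := fun _ st =>
  \sum_i early_excess i st + \sum_i far i st)); last first.
  move=> b st; rewrite sum_mass_card -big_split; apply: eq_bigr => i _ /=.
  rewrite /early_excess /far [in X in _ + X](bigD1 i) //= mulrAC -mulrDl.
  congr (_ * _); rewrite /excess /block_common /block_weight; case: leqP => _.
    by rewrite mulr0 addr0.
  by rewrite mulr1 add0r subr0.
rewrite leafsumD; apply: lerD.
  rewrite (leafsum_sum _ _ _ (fun i _ st => early_excess i st)).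
  rewrite mulrC -[X in X%:R * _](card_ord n) -sumr_const mulr_suml.
  apply: ler_sum => i _; rewrite mul1r.
  have [//|u] := leafsum_block mu_ge0 (d := d) t (st := start) z (i := i).
  rewrite subn0 => ud le; apply: (le_trans le).
  rewrite /= big1 ?mulr1 => [|j _]; last exact: weightT.
  by have := mu_hard ud; rewrite weightT; lra.
apply: (@le_trans _ _ (leafsum (@block_next m) t start (fun b st =>
   (\prod_i block_weight mu (z i) (st i)) * ((reads st)%:R / d.+1%:R)))).
  apply: le_leafsum => b st; rewrite -mulr_sumr ler_wpM2l //.
    by apply: prodr_ge0 => i _; apply: weight_ge0.
  rewrite ler_pdivlMr ?ltr0n // /reads natr_sum mulr_suml.
  apply: ler_sum => i _; case: ltnP => [lt|_]; last by rewrite mul0r.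
  by rewrite mul1r ler_nat.
have -> := leafsum_input mu t start z (fun _ q => q%:R / d.+1%:R).
apply: (@le_trans _ _ (\sum_x @input_weight K n m mu z x * (T%:R / d.+1%:R)));
  last by rewrite -mulr_suml sum_input_weight mul1r.
apply: ler_sum => x _; rewrite [X in _ * X * _](_ : _ = 1) ?mulr1; last first.
  by rewrite (_ : [forall _, _]) //; apply/forallP => i; rewrite inE.
apply: ler_wpM2l; first by apply: prodr_ge0.
rewrite ler_wpM2r ?invr_ge0 // ler_nat.
by rewrite /reads big1 ?add0n ?tT.
Qed.

(** Each seed of [A] is simulated separately. Inputs of positive weight have block values [z], so
    the error at [z] is an average of errors of [A] on inputs where the composition equals [f z]. *)
Lemma composition_simulation (f : pbool n) (g : pbool m)
    (A : ralg K (n * m)) e :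
  (forall b x, g x != Some b -> mu b x = 0) ->
  (forall x, pbool_comp f g x != None -> err A (pbool_comp f g) x <= e) ->
  exists B : ralg K n, forall z, f z != None ->
    err B f z <= e /\
    expect B z (fun _ q => q%:R) <= gamma * n%:R + (cost A)%:R / d.+1%:R.
Proof.
move=> mu_g Ae.
exists (mix (fun s => simulation (tree s)) (@prob_ge0 _ _ A) (prob_sum1 A)).
move=> z fz.
split; last first.
  rewrite expect_mix; set M := _ + _.
  apply: (@le_trans _ _ (\sum_(s : seed A) prob s * M));
    last by rewrite -mulr_suml prob_sum1 mul1r.
  apply: ler_sum => s _; rewrite ler_wpM2l ?prob_ge0 //.
  by apply: simulation_queries => x; apply: queries_le_cost.
rewrite err_expect expect_mix.
under eq_bigr => s _ do rewrite simulation_output mulr_sumr.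
rewrite exchange_big.
apply: (@le_trans _ _ (\sum_x @input_weight K n m mu z x * e));
  last by rewrite -mulr_suml sum_input_weight mul1r.
apply: ler_sum => x _ /=.
under eq_bigr => s _ do rewrite mulrCA.
rewrite -mulr_sumr.
have [x_g|] := boolP [forall i, g (x i) == Some (z i)]; last first.
  case/forallPn => i /mu_g xi.
  by rewrite /input_weight (bigD1 i) //= xi !mul0r.
apply: ler_wpM2l; first by apply: prodr_ge0.
have compE : pbool_comp f g (flat x) = f z.
  rewrite /pbool_comp; case: ifPn => [_|/forallPn[i]]; last first.
    by rewrite block_flat (eqP (forallP x_g i)).
  congr f; apply/ffunP => i.
  by rewrite ffunE block_flat (eqP (forallP x_g i)).
by have := Ae (flat x); rewrite err_expect compE => /(_ fz).
Qed.

End Core.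

(** * From expected to worst-case queries, and the choice of constants *)

Fixpoint dtruncate n (D : nat) (t : dtree n) : dtree n :=
  match t, D with
  | Leaf b, _ => Leaf b
  | Query i t0 t1, D'.+1 => Query i (dtruncate D' t0) (dtruncate D' t1)
  | Query _ _ _, 0 => Leaf false
  end.

Lemma queries_dtruncate n D (t : dtree n) x : (queries (dtruncate D t) x <= D)%N.
Proof.
by elim: t D => [b|i t0 IH0 t1 IH1] [|D] //=; rewrite ltnS; case: (x i).
Qed.

Lemma eval_dtruncate n D (t : dtree n) x : (queries t x <= D)%N ->
  eval (dtruncate D t) x = eval t x.
Proof.
by elim: t D => [b|i t0 IH0 t1 IH1] [|D] //=; rewrite ltnS;
  case: (x i); auto.
Qed.

(** By Markov's inequality more than [D] queries occur with probability at most 1/6; cutting there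
    raises the error from 1/6 to at most 1/3. *)
Lemma rqc_le_expected (K : realType) n (h : pbool n) (B : ralg K n) (M : K)
    (D : nat) :
  (forall x, h x != None ->
     err B h x <= 6^-1 /\ expect B x (fun _ q => q%:R) <= M) ->
  6 * M <= D.+1%:R -> (rqc K h <= D)%N.
Proof.
move=> Bh MD.
pose B' := RAlg (@prob_ge0 _ _ B) (prob_sum1 B) (fun s => dtruncate D (tree s)).
have cB' : (cost B' <= D)%N by apply: cost_le => s x; apply: queries_dtruncate.
apply: leq_trans cB'; apply: rqc_le => x hx; have [eB qB] := Bh x hx.
have D0 : 0 < D.+1%:R :> K by rewrite ltr0n.
apply: (@le_trans _ _ (expect B x (fun b q =>
  (Some b != h x)%:R + D.+1%:R^-1 * q%:R))).
  rewrite err_expect /expect /=; apply: ler_sum => s _.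
  rewrite ler_wpM2l ?prob_ge0 //; have [qD|Dq] := leqP (queries (tree s) x) D.
    by rewrite eval_dtruncate // lerDl mulr_ge0 // invr_ge0.
  apply: (@le_trans _ _ 1); first by rewrite lern1 leq_b1.
  by rewrite -[leLHS]add0r lerD // ler_pdivlMl // mulr1 ler_nat.
rewrite expectD expectZ -err_expect.
have qD : D.+1%:R^-1 * expect B x (fun _ q => q%:R) <= 6^-1.
  by rewrite ler_pdivrMl //; lra.
by apply: (le_trans (lerD eB qD)); lra.
Qed.

Theorem theorem2p1 (K : realType) (n : nat -> nat) (f : forall k, pbool (n k))
    (n_oo : n @ \oo --> \oo)
    (Rf : (fun k => (rqc K (f k))%:R : K) \is 'Theta_\oo (fun k => (n k)%:R : K)) :
  exists2 c : K, 0 < c &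
    \forall k \near \oo, forall (m : nat) (g : pbool m),
      c * ((rqc K (f k))%:R * (rqc K g)%:R) <= (rqc K (pbool_comp (f k) g))%:R.
Proof.
have [c0 c00 near_c0] : exists2 c0 : K, 0 < c0 &
    \forall k \near \oo, c0 * (n k)%:R <= (rqc K (f k))%:R.
  have /asboolP[[c0 c1] /= /andP[c00 _] near_c] := Rf.
  exists c0 => //; apply: filterS near_c => k [+ _].
  by rewrite !ger0_norm.
(* The pair has [gamma = 4 * eta], and Markov costs a factor 6; with 48 the term 24 eta n is at most
   half of [R]. *)
pose eta := Num.min 4^-1 (c0 / 48).
have eta0 : 0 < eta by rewrite lt_min invr_gt0 ltr0n divr_gt0.
have eta4 : eta <= 4^-1 by rewrite ge_min lexx.
have etac : eta <= c0 / 48 by rewrite ge_min lexx orbT.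
have [|r r0 amp] := @amplification K 6^-1; first by apply/andP; split; lra.
have [|l l0 ampg] := @amplification K (eta / 2); first by apply/andP; split; lra.
exists (12 * r%:R * l%:R)^-1; first by rewrite invr_gt0 !mulr_gt0 ?ltr0n.
apply: filterS near_c0 => k; set R := rqc K (f k) => c0R m g.
case: (posnP R) => [->|Rpos]; first by rewrite mul0r mulr0.
case: (posnP (rqc K g)) => [->|gpos]; first by rewrite !mulr0.
(* The largest [d] with [d * l < rqc K g]: an algorithm of cost at most [d] with advantage [eta / 2]
   would amplify to one cheaper than [rqc K g]. *)
pose d := ((rqc K g).-1 %/ l)%N.
have ld : (d * l < rqc K g)%N by rewrite -(prednK gpos) ltnS leq_trunc_div.
have lgd : (rqc K g <= d.+1 * l)%N by rewrite -(prednK gpos) ltn_ceil.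
have [|A Ag|mu [mu0 mu1 mug muhard]] := @hard_pair K m g d eta.
- by rewrite eta0.
- have [B Bg Bc] := ampg m g A Ag; rewrite ltnNge; apply/negP => Ad.
  have : (rqc K g <= d * l)%N.
    apply: leq_trans (rqc_le _) (leq_trans Bc _).
      by move=> x /Bg /le_trans; apply; lra.
    by rewrite mulnC leq_mul2r Ad orbT.
  by rewrite leqNgt ld.
have [A Afg Ac] := rqc_computes K (pbool_comp (f k) g).
have [|B Be Bc] := amp _ (pbool_comp (f k) g) A.
  by move=> x /Afg /le_trans; apply; lra.
have [C HC] := composition_simulation mu0 mu1 muhard mug Be.
rewrite ler_pdivrMl ?mulr_gt0 ?ltr0n //.
(* If the expected number of queries were this small, truncating at [R.-1] would compute [f k] with
   fewer than [R] queries. *)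
have [RM|MR] := leP (6 * (4 * eta * (n k)%:R + (cost B)%:R / d.+1%:R)) R%:R.
  have := rqc_le_expected (D := R.-1) HC.
  by rewrite prednK // leqNgt prednK // leqnn => /(_ RM).
have d0 : 0 < d.+1%:R :> K by rewrite ltr0n.
have {MR}MR : R%:R <= 12 * ((cost B)%:R / d.+1%:R) :> K.
  have en : eta * (n k)%:R <= c0 / 48 * (n k)%:R by apply: ler_wpM2r.
  move: MR c0R en; move: ((cost B)%:R / _) (R%:R) => v u.
  move: (n k)%:R => w; lra.
(* Multiplying by the bound [lgd] on [rqc K g] cancels [d.+1]; the factor [r] then comes from
   amplifying [A] to [B]. *)
apply: (@le_trans _ _ (12 * ((cost B)%:R / d.+1%:R) * (d.+1 * l)%:R)).
  by apply: ler_pM => //; rewrite ler_nat.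
rewrite natrM; have -> : 12 * ((cost B)%:R / d.+1%:R) * (d.+1%:R * l%:R) =
  12 * l%:R * (cost B)%:R :> K by field; rewrite gt_eqF.
have Br : (cost B)%:R <= r%:R * (rqc K (pbool_comp (f k) g))%:R :> K.
  by rewrite -natrM ler_nat -Ac.
by have := ler_wpM2l (ler0n K l) Br; lra.
Qed.
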